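(* For every integer $r\geq 3$ we have \[ \delta_{\hom}(K_r)=\frac{2r-5}{2r-3}. \] Equivalently: the infimum of all $\alpha\in[0,1]$ for which there exists $k\in\mathbb N$ such that every $K_r$-free graph $G$ with $\delta(G)\geq \alpha|V(G)|$ admits a homomorphism into some $K_r$-free graph $H$ on $k$ vertices, equals $\frac{2r-5}{2r-3}$.
   Context: All graphs are finite, simple, undirected and loopless. $K_r$ denotes the complete graph on $r$ vertices; a graph is $F$-free if it contains no (not necessarily induced) subgraph isomorphic to $F$. $\delta(G)$ is the minimum degree of $G$. A homomorphism from $G$ to $H$ is a map $\phi\colon V(G)\to V(H)$ such that $\phi(u)\phi(v)\in E(H)$ whenever $uv\in E(G)$; write $G\to H$ if one exists. For a graph $F$, $\mathrm{Forb}(F)$ is the class of $F$-free graphs and $\mathrm{Forb}_k(F)$ the class of $F$-free graphs on exactly $k$ vertices. The homomorphism threshold of $F$ is \[ \delta_{\hom}(F)=\inf\{\alpha\in[0,1]\colon \exists k\in\mathbb N \text{ such that } \forall G\in\mathrm{Forb}(F) \text{ with } \delta(G)\geq\alpha|V(G)|\ \exists H\in\mathrm{Forb}_k(F) \text{ with } G\to H\}. \] *)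

(* Defs.v *)
From mathcomp Require Import all_boot all_order all_algebra.
From mathcomp Require Import all_classical all_reals.
Set Implicit Arguments.
Unset Strict Implicit.
Unset Printing Implicit Defensive.
Import Order.TTheory GRing.Theory Num.Theory.
Local Open Scope ring_scope.
Local Open Scope classical_set_scope.

Record sgraph := SGraph {
  vertex :> finType;
  adj : rel vertex;
  adj_sym : symmetric adj;
  adj_irrefl : irreflexive adj }.

Lemma complete_adj_sym r : symmetric (fun i j : 'I_r => i != j).
Proof. by move=> i j; rewrite eq_sym. Qed.

Lemma complete_adj_irrefl r : irreflexive (fun i j : 'I_r => i != j).
Proof. by move=> i; rewrite eqxx. Qed.

Definition complete_graph (r : nat) : sgraph :=
  SGraph (@complete_adj_sym r) (@complete_adj_irrefl r).

Definition graph_hom (G H : sgraph) (phi : G -> H) : Prop :=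
  forall u v : G, adj u v -> adj (phi u) (phi v).

Definition hom_to (G H : sgraph) : Prop :=
  exists phi : G -> H, graph_hom phi.

(* A copy of F in G, not necessarily induced, is an injective homomorphism. *)
Definition contains_subgraph (G F : sgraph) : Prop :=
  exists phi : F -> G, injective phi /\ graph_hom phi.

Definition Forb (F G : sgraph) : Prop := ~ contains_subgraph G F.

Definition Forb_on (k : nat) (F G : sgraph) : Prop := Forb F G /\ #|G| = k.

Definition degree (G : sgraph) (v : G) : nat := #|[pred u : G | adj v u]|.

(* Every degree is below #|G|, so the default value #|G| matters only for the
   graph without vertices, whose minimum degree is 0 by convention. *)
Definition min_degree (G : sgraph) : nat :=
  \big[minn/#|G|]_(v : G) degree v.

Definition hom_threshold (R : realType) (F : sgraph) : R :=
  inf [set alpha : R | 0 <= alpha <= 1 /\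
    exists k : nat, forall G : sgraph, Forb F G ->
      (min_degree G)%:R >= alpha * #|G|%:R ->
      exists H : sgraph, Forb_on k F H /\ hom_to G H].

(* Main.v *)
(** Upper bound.  Write [n] for the number of vertices and [s = r - 2].  For a
    vertex [u] and an [s]-tuple [Q] let [link u Q] be the set of common
    neighbours of [u] and all of [Q].  If [Q] is a clique inside the
    neighbourhood of [u], then [link u Q] is empty, as the graph is [K_r]-free;
    if [u] and [v] are adjacent, a degree count shows that [link u Q] and
    [link v Q] cannot both be small, for any [Q].  Call [u] close to [c] if only
    few [Q] have a large [link u Q] and an empty [link c Q].  A random sample of
    bounded size detects large links, so the trace of [u] on the sample bounds
    the size of a family of pairwise non-close vertices, and the vertices split
    into boundedly many classes, each consisting of vertices close to a centre.
    Suppose that [r] classes with centres [c_1, ..., c_r] are pairwise joined by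
    an edge.  Choosing [s] vertices greedily, each time losing at most one
    centre, gives a positive proportion of cliques [Q] that lie in the common
    neighbourhood of two centres [c_i], [c_j]; both [link c_i Q] and
    [link c_j Q] are empty, although an edge joins their classes, which
    contradicts closeness for a typical [Q].

    Lower bound.  Let [A] be complete to [B] with [#|A| = 2 * #|B|], and add a
    small matching whose edges [uv] split [A] into two halves, the neighbours of
    [u] and of [v].  Any map to at most [k] vertices identifies two vertices of
    [A] separated by some edge [uv], which creates a triangle in the image.
    Joining with [r - 3] further independent sets of size [#|A|] handles all
    [r]. *)

Require Import Defs.
From HB Require Import structures.
From mathcomp Require Import all_boot all_order all_algebra.
From mathcomp Require Import zify lra.
Set Implicit Arguments.
Unset Strict Implicit.
Unset Printing Implicit Defensive.
Import Order.TTheory GRing.Theory Num.Theory.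
Local Open Scope nat_scope.

(** * Finite counting *)

Lemma sum_tupleS (T : finType) (t : nat) (F : t.+1.-tuple T -> nat) :
  \sum_Q F Q = \sum_(y : T) \sum_(Q : t.-tuple T) F [tuple of y :: Q].
Proof.
rewrite pair_bigA /= (reindex (fun z : T * t.-tuple T => [tuple of z.1 :: z.2])) //=.
exists (fun Q : t.+1.-tuple T => (thead Q, [tuple of behead Q])) => [[y Q] _|Q _] /=.
  by congr pair; apply: val_inj.
by case/tupleP: Q => y Q; apply: val_inj.
Qed.

Lemma card_tupleS (T : finType) (t : nat) (P : pred (t.+1.-tuple T)) :
  #|[set Q | P Q]| = \sum_y #|[set Q : t.-tuple T | P [tuple of y :: Q]]|.
Proof.
rewrite -sum1dep_card big_mkcond sum_tupleS; apply: eq_bigr => y _.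
by rewrite -big_mkcond sum1dep_card.
Qed.

Lemma sum_bool_card (T : finType) (P : pred T) : \sum_x (P x : nat) = #|[set x | P x]|.
Proof. by rewrite -sum1dep_card [RHS]big_mkcond; apply: eq_bigr => x _; case: (P x). Qed.

Lemma sum_card_exchange (S T : finType) (P : S -> T -> bool) :
  \sum_x #|[set y | P x y]| = \sum_y #|[set x | P x y]|.
Proof.
under eq_bigr do rewrite -sum_bool_card.
by rewrite exchange_big /=; apply: eq_bigr => y _; rewrite sum_bool_card.
Qed.

(** Bernoulli's inequality [(1 + 1/x)^m >= 1 + m/x] at [m = c * x]; this will fix the sample
    size. *)
Lemma exists_exponent (x c : nat) : 0 < x -> exists m, c * x ^ m <= x.+1 ^ m.
Proof.
move=> x0; exists (c * x).
have bern m : x * x ^ m + m * x ^ m <= x * x.+1 ^ m.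
  elim: m => [|m IH]; first by rewrite !expn0; lia.
  rewrite !expnS; move: (x ^ m) (x.+1 ^ m) IH => a b; nia.
rewrite -(leq_pmul2l x0); have := bern (c * x).
move: (x ^ _) (x.+1 ^ _) => a b; nia.
Qed.

(** * Links of tuples in dense clique-free graphs *)

Section DenseGraph.

Variables (V : finType) (adj : rel V).
Hypothesis adj_sym : symmetric adj.
Variable n : nat.
Hypothesis cardV : #|V| = n.
Implicit Types (u v w c : V) (Q X L : seq V).

Definition common Q : {set V} := [set w | all (adj w) Q].
Definition link u Q : {set V} := [set w | adj w u && all (adj w) Q].

Section Degree.
Variable d : nat.
Hypothesis nondeg : forall v, #|[set u | ~~ adj v u]| <= d.

Lemma nondegree_inter (W : {set V}) v : #|W| <= #|[set w in W | adj v w]| + d.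
Proof.
apply: leq_trans (leq_add (leqnn _) (nondeg v)).
apply: leq_trans (leq_card_setU _ _); apply: subset_leq_card.
by apply/subsetP => w wW; rewrite !inE wW /=; case: adj.
Qed.

(** Greedy choice: each chosen vertex removes at most [d] candidates. *)
Lemma clique_in_large_set (t : nat) (W : {set V}) : t * d < #|W| ->
  exists L, [/\ size L = t.+1, pairwise adj L & {subset L <= W}].
Proof.
elim: t W => [|t IH] W.
  rewrite mul0n card_gt0 => /set0Pn[w wW].
  by exists [:: w]; split=> // x; rewrite inE => /eqP->.
move=> lt; have /card_gt0P[w wW] : 0 < #|W| by lia.
have le := nondegree_inter W w.
have [|L [sL pL subL]] := IH [set x in W | adj w x].
  by rewrite mulSn in lt; lia.
exists (w :: L); split => /=; first by rewrite sL.
  by rewrite pL andbT; apply/allP => x /subL; rewrite inE => /andP[].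
by move=> x; rewrite inE => /predU1P[->//|/subL]; rewrite inE => /andP[].
Qed.

Lemma card_common X : n <= #|common X| + size X * d.
Proof.
elim: X => [|x X IH].
  rewrite addn0 -cardV -cardsT; apply: subset_leq_card.
  by apply/subsetP => w _; rewrite inE.
have le := nondegree_inter (common X) x.
have -> : common (x :: X) = [set w in common X | adj x w].
  by apply/setP => w; rewrite !inE /= andbC adj_sym.
by rewrite [size _]/= mulSn; lia.
Qed.

Section CliqueFree.
Variables (s e : nat).
Hypothesis s_gt0 : 0 < s.
(** Minimum degree [(2s-1)n/(2s+1)], the threshold for [r = s + 2], corresponds to [(2s+1)d = 2n];
    [e] measures the excess over it. *)
Hypothesis degE : s.*2.+1 * d + e <= 2 * n.
Hypothesis Kfree : forall L, size L = s.+2 -> ~~ pairwise adj L.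

Lemma link_clique c Q : size Q = s -> pairwise adj Q -> all (adj c) Q -> link c Q = set0.
Proof.
move=> sQ pQ cQ; apply/setP => w; rewrite !inE; apply/negP => /andP[wc wQ].
have := Kfree (L := [:: w, c & Q]); rewrite /= sQ wc wQ cQ pQ => /(_ erefl).
by [].
Qed.

Lemma degree_sum Q : size Q * n <= \sum_w count (adj w) Q + size Q * d.
Proof.
elim: Q => [//|x Q IH].
rewrite /= big_split /= sum_bool_card.
have := nondegree_inter setT x; rewrite cardsT cardV.
have -> : [set w in setT | adj x w] = [set w | adj w x].
  by apply/setP => w; rewrite !inE adj_sym.
by rewrite !mulSn; lia.
Qed.

(** Count the edges into [u, v, Q]: a vertex contributes at most [s] plus the number of sets
    containing it among the two links and the common neighbourhood of [u, v]. The latter has at most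
    [(s-1)d] vertices, since otherwise a greedy clique in it would complete [uv] to a forbidden
    one. *)
Lemma link_edge u v Q : size Q = s -> adj u v -> e <= #|link u Q| + #|link v Q|.
Proof.
move=> sQ uv.
have := degree_sum [:: u, v & Q]; rewrite [size _]/= sQ.
have Wle : #|[set w | adj w u && adj w v]| <= s.-1 * d.
  rewrite leqNgt; apply/negP => /clique_in_large_set[L [sL pL subL]].
  have := Kfree (L := [:: u, v & L]); rewrite /= sL uv pL prednK // => /(_ erefl).
  rewrite andbT /= => /negP; apply; apply/andP.
  by split; apply/allP => x /subL; rewrite inE => /andP[]; rewrite ![adj x _]adj_sym.
suff : \sum_w count (adj w) [:: u, v & Q] <=
    s * n + #|[set w | adj w u && adj w v]| + #|link u Q| + #|link v Q|.
  by case: (s) s_gt0 degE Wle => // s' _; rewrite [_.-1]/=; nia.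
rewrite -!sum_bool_card mulnC -cardV -sum_nat_const -!big_split /=; apply: leq_sum => w _.
have := count_size (adj w) Q; rewrite sQ all_count sQ.
by case: (adj w u); case: (adj w v); case: (eqVneq (count (adj w) Q) s) => /=; lia.
Qed.

Definition doubly_dominated (I : finType) (c : I -> V) L : bool :=
  [exists i, exists j, [&& i != j, all (adj (c i)) L & all (adj (c j)) L]].

(** Induction on the number [t] of vertices still to choose; [J] lists [t+2] centres adjacent to all
    of the chosen [X]. At each step at least [e/2] choices lose at most one centre. With [catrev],
    extending the tuple and extending [X] agree by computation. *)
Lemma count_dominated_cliques (I : finType) (c : I -> V) t X (J : seq I) :
    size X + t = s -> pairwise adj X -> uniq J -> size J = t.+2 ->
    {in J, forall i, all (adj (c i)) X} ->
  e ^ t <= 2 ^ t * #|[set Q : t.-tuple V |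
     pairwise adj (catrev Q X) && doubly_dominated c (catrev Q X)]|.
Proof.
elim: t X J => [|t IH] X J sX pX uJ sJ JX.
  rewrite !expn0 mul1n card_gt0; apply/set0Pn; exists [tuple].
  rewrite inE /= pX /=.
  case: J uJ sJ JX => [|i [|j [|//]]] //= /andP[ij _] _ JX.
  apply/existsP; exists i; apply/existsP; exists j.
  by rewrite !JX ?inE ?eqxx ?orbT // !andbT; move: ij; rewrite inE.
pose act y := [seq i <- J | adj (c i) y].
pose good := [set y in common X | t.+1 < size (act y)].
have good_ge : e <= 2 * #|good|.
  have h1 : t.+3 * #|common X| <= \sum_(y in common X) size (act y) + t.+3 * d.
    rewrite -sJ /act; elim: (J) => [|i J' IHJ]; first by rewrite !mul0n.
    have := nondegree_inter (common X) (c i).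
    rewrite -[#|[set w in _ | _]|]sum1dep_card /=.
    have -> : \sum_(y in common X) size [seq k <- i :: J' | adj (c k) y] =
      \sum_(y in common X) (adj (c i) y : nat) +
      \sum_(y in common X) size [seq k <- J' | adj (c k) y].
      by rewrite -big_split; apply: eq_bigr => y _ /=; case: adj.
    have -> : \sum_(y in common X | adj (c i) y) 1 = \sum_(y in common X) (adj (c i) y : nat).
      by rewrite big_mkcondr; apply: eq_bigr => y _ /=; case: adj.
    by rewrite /= !mulSn; lia.
  (* A good vertex sees at most all [t+3] centres, any other at most [t+1]. *)
  have h2 : \sum_(y in common X) size (act y) <= t.+1 * #|common X| + 2 * #|good|.
    have -> : #|good| = \sum_(y in common X) (t.+1 < size (act y) : nat).
      by rewrite -sum1dep_card big_mkcondr; apply: eq_bigr => y _; case: ltnP.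
    rewrite mulnC -sum_nat_const big_distrr -big_split /=; apply: leq_sum => y _.
    have : size (act y) <= t.+3 by rewrite -sJ size_filter count_size.
    by case: ltnP => /=; lia.
  have h3 := card_common X.
  (* Together, [2 * #|good|] is at least [2n - (2|X| + t + 3)d], and here
     [2|X| + t + 3 = |X| + s + 2 <= 2s + 1]. *)
  have : size X + t.+1 <= s by rewrite sX.
  move: degE h1 h2 h3; move: #|common X| #|good| (size X) (\sum_(y in _) _) => N g j S.
  by rewrite -muln2 => *; nia.
rewrite card_tupleS /= !expnS.
apply: leq_trans (leq_mul good_ge (leqnn _)) _.
rewrite -!mulnA leq_pmul2l // big_distrr /=.
apply: (@leq_trans (\sum_(y in good) e ^ t)); first by rewrite sum_nat_const.
rewrite [leqRHS](bigID (mem good)) /=; apply: leq_trans (leq_addr _ _).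
apply: leq_sum => y; rewrite !inE => /andP[yX ty].
apply: (IH (y :: X) (take t.+2 (act y))) => /=.
- by rewrite addSnnS.
- by rewrite yX.
- by rewrite take_uniq // filter_uniq.
- by rewrite size_takel.
- by move=> i /mem_take; rewrite mem_filter => /andP[-> /JX].
Qed.

End CliqueFree.
End Degree.

(** * Closeness of vertices and sampling *)

Section Sampling.
Variables (s p : nat).
Hypothesis p_gt0 : 0 < p.
Hypothesis n_gt0 : 0 < n.

(** When [n <= p * e], [link_edge] makes at least one end of every edge heavy, for each
    [s]-tuple. *)
Definition heavy u Q : bool := n <= 2 * p * #|link u Q|.

(* The factor [(2 * p) ^ s] pays for the density of the tuples found greedily,
   and [2 * s.+2 ^ 2] for a union bound over ordered pairs of classes. *)
Definition rare_factor : nat := (2 * p) ^ s * (2 * s.+2 ^ 2).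
Definition rare (B : {set s.-tuple V}) : bool := rare_factor * #|B| < n ^ s.
Definition separating u c : {set s.-tuple V} :=
  [set Q : s.-tuple V | heavy u Q && (link c Q == set0)].
Definition close u c : bool := rare (separating u c).

Section Sample.
Variable m : nat.
Implicit Type Y : {ffun 'I_m -> V}.

Definition missed u Y : {set s.-tuple V} :=
  [set Q : s.-tuple V | heavy u Q && [forall a, Y a \notin link u Q]].
Definition pattern u Y : {ffun 'I_m -> bool} := [ffun a => adj (Y a) u].

(** A sample point in [link u Q] is adjacent to [u], hence to [c] by equality of patterns, so it
    lies in [link c Q]. Thus every tuple separating [u] from [c] is missed. *)
Lemma close_of_pattern u c Y : rare (missed u Y) -> pattern u Y = pattern c Y -> close u c.
Proof.
move=> + pat; apply: leq_ltn_trans; rewrite leq_mul2l; apply/orP; right.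
apply: subset_leq_card; apply/subsetP => Q; rewrite !inE => /andP[-> /eqP c0] /=.
apply/forallP => a; apply/negP; rewrite inE => /andP[ua aQ].
have /ffunP/(_ a) := pat; rewrite !ffunE ua => ca.
by have : Y a \in link c Q; [rewrite inE -ca aQ|rewrite c0 inE].
Qed.

Lemma card_sample_missing u Q : heavy u Q ->
  (2 * p) ^ m * #|[set Y : {ffun 'I_m -> V} | [forall a, Y a \notin link u Q]]| <=
    (2 * p).-1 ^ m * n ^ m.
Proof.
move=> hQ.
have -> : #|[set Y : {ffun 'I_m -> V} | [forall a, Y a \notin link u Q]]| =
    #|~: link u Q| ^ m.
  rewrite -[in RHS](card_ord m) -card_ffun_on; apply: eq_card => Y.
  by rewrite inE; apply/forallP/ffun_onP => H a; move: (H a); rewrite in_setC.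
rewrite -!expnMn; case: (posnP m) => [->//|m0]; rewrite leq_exp2r //.
have := cardsC (link u Q); rewrite cardV; move: hQ; rewrite /heavy.
by move: #|link u Q| #|~: _| p_gt0 => a b; nia.
Qed.

Hypothesis m_large : 2 * rare_factor * (2 * p).-1 ^ m <= (2 * p) ^ m.

(** Markov's inequality: the mean number of missed tuples is at most [n^s (1 - 1/(2p))^m], which is
    at most [n^s / (2 * rare_factor)]. *)
Lemma card_bad_samples u : 2 * #|[set Y | ~~ rare (missed u Y)]| <= n ^ m.
Proof.
have h1 : n ^ s * #|[set Y | ~~ rare (missed u Y)]| <= rare_factor * \sum_Y #|missed u Y|.
  rewrite mulnC -sum_nat_const big_distrr /=.
  rewrite [leqRHS](bigID (mem [set Y | ~~ rare (missed u Y)])) /=.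
  apply: leq_trans (leq_addr _ _); apply: leq_sum => Y.
  by rewrite inE /rare -leqNgt.
have h2 : (2 * p) ^ m * (\sum_Y #|missed u Y|) <= n ^ s * ((2 * p).-1 ^ m * n ^ m).
  rewrite sum_card_exchange big_distrr /= -[in leqRHS]cardV -card_tuple -sum_nat_const cardV.
  apply: leq_sum => Q _.
  case hQ: (heavy u Q) => /=; first exact: card_sample_missing.
  by rewrite (_ : [set _ | _] = set0) ?cards0 ?muln0 //; apply/setP => Y; rewrite !inE.
have n0 : 0 < n ^ s by rewrite expn_gt0 n_gt0.
have p0 : 0 < (2 * p) ^ m by rewrite expn_gt0; lia.
rewrite -(leq_pmul2l n0) -(leq_pmul2l p0).
move: (n ^ s) (n ^ m) #|_| (\sum_Y _) ((2 * p) ^ m) ((2 * p).-1 ^ m) rare_factor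
  m_large h1 h2 => a b g S P q F; clear=> h h1 h2.
apply: (@leq_trans (2 * F * (P * S))); first by nia.
apply: (@leq_trans (2 * F * (a * (q * b)))); first by nia.
by have := leq_mul h (leqnn (a * b)); nia.
Qed.

(** By averaging, some sample is good for at least half of [T]; on that half, equal patterns would
    give mutual closeness, so patterns are distinct. *)
Lemma card_separated (T : {set V}) :
  {in T &, forall u v, u != v -> ~~ (close u v && close v u)} -> #|T| <= 2 * 2 ^ m.
Proof.
move=> sepT.
have n0 : 0 < n ^ m by rewrite expn_gt0 n_gt0.
have [Y TY] : exists Y, #|T| <= 2 * #|[set u in T | rare (missed u Y)]|.
  apply/existsP; rewrite -[[exists _, _]]negbK negb_exists; apply/negP => /forallP H.
  have : \sum_Y (2 * #|[set u in T | rare (missed u Y)]|).+1 <= n ^ m * #|T|.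
    rewrite -[in leqRHS](card_ord m) -cardV -card_ffun -sum_nat_const.
    by apply: leq_sum => Y _; rewrite ltnNge.
  rewrite (eq_bigr (fun Y => 2 * #|[set u in T | rare (missed u Y)]| + 1)) => [|Y _];
    last by rewrite addn1.
  rewrite big_split -big_distrr /= sum1_card card_ffun card_ord cardV sum_card_exchange.
  rewrite (bigID (mem T)) /=.
  have : #|T| * n ^ m <= 2 * \sum_(u in T) #|[set Y | (u \in T) && rare (missed u Y)]|.
    rewrite big_distrr -sum_nat_const /=; apply: leq_sum => u uT; rewrite uT /=.
    have := card_bad_samples u; have := cardsC [set Y | rare (missed u Y)].
    rewrite card_ffun card_ord cardV.
    have -> : ~: [set Y | rare (missed u Y)] = [set Y | ~~ rare (missed u Y)].
      by apply/setP => Y; rewrite !inE.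
    by rewrite /=; lia.
  by rewrite /=; lia.
apply: leq_trans TY _; rewrite leq_mul2l /=.
have -> : 2 ^ m = #|{ffun 'I_m -> bool}| by rewrite card_ffun card_bool card_ord.
rewrite -(card_in_imset (f := pattern^~ Y)) ?max_card // => u v.
rewrite !inE => /andP[uT gu] /andP[vT gv] puv; apply: contraTeq isT => uv.
have := sepT u v uT vT uv.
by rewrite (close_of_pattern gu puv) (close_of_pattern gv (esym puv)).
Qed.

End Sample.

Lemma close_refl u : close u u.
Proof.
rewrite /close /rare (_ : separating u u = set0) ?cards0 ?muln0 ?expn_gt0 ?n_gt0 //.
apply/setP => Q; rewrite !inE /heavy; apply/negP => /andP[h /eqP u0].
by move: h; rewrite u0 cards0 muln0 leqNgt n_gt0.
Qed.

(** Take a maximal set without mutually close pairs: a vertex close to none of its members could be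
    added. *)
Lemma close_net (m : nat) : 2 * rare_factor * (2 * p).-1 ^ m <= (2 * p) ^ m ->
  exists2 T : {set V}, #|T| <= 2 * 2 ^ m & forall u, exists2 c, c \in T & close u c.
Proof.
move=> m_large.
pose sep (T : {set V}) := [forall u in T, forall v in T,
  (u != v) ==> ~~ (close u v && close v u)].
have sepP (T : {set V}) : reflect
    {in T &, forall u v, u != v -> ~~ (close u v && close v u)} (sep T).
  apply: (iffP forall_inP) => [H u v uT vT uv|H u uT].
    by have /forall_inP/(_ v vT)/implyP/(_ uv) := H u uT.
  by apply/forall_inP => v vT; apply/implyP; apply: H.
have [T /maxsetP[/sepP sepT maxT] _] : {T | maxset sep T & set0 \subset T}.
  by apply: maxset_exists; apply/sepP => u v; rewrite inE.
exists T; first exact: card_separated m_large _ sepT.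
move=> u; have [uT|uT] := boolP (u \in T); first by exists u => //; apply: close_refl.
apply/exists_inP; rewrite -[[exists _ in _, _]]negbK negb_exists_in.
apply/negP => /forall_inP H; case/negP: uT.
rewrite -(maxT (u |: T)) ?setU11 ?subsetUr //; apply/sepP => x y.
rewrite !inE => /predU1P[->|xT] /predU1P[->|yT]; rewrite ?eqxx // => xy.
- by rewrite negb_and H.
- by rewrite negb_and H ?orbT.
- exact: sepT.
Qed.

Lemma bounded_close_labelling (m : nat) :
    2 * rare_factor * (2 * p).-1 ^ m <= (2 * p) ^ m ->
  exists (f : V -> 'I_(2 * 2 ^ m)) (cen : 'I_(2 * 2 ^ m) -> V), forall u, close u (cen (f u)).
Proof.
move=> m_large; have /card_gt0P[x0 _] : 0 < #|V| by rewrite cardV.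
have [T cardT netT] := close_net m_large.
suff /fin_all_exists[f fP] : forall u, exists i : 'I_(2 * 2 ^ m), close u (nth x0 (enum T) i).
  by exists f; exists (fun i => nth x0 (enum T) i).
move=> u; have [c cT uc] := netT u.
have ltc : index c (enum T) < 2 * 2 ^ m.
  by apply: leq_trans cardT; rewrite cardE index_mem mem_enum.
by exists (Ordinal ltc); rewrite /= nth_index // mem_enum.
Qed.

(** * Absence of cliques among the classes *)

Section Quotient.
Variables (d e : nat).
Hypothesis nondeg : forall v, #|[set u | ~~ adj v u]| <= d.
Hypothesis s_gt0 : 0 < s.
Hypothesis degE : s.*2.+1 * d + e <= 2 * n.
Hypothesis n_le_e : n <= p * e.
Hypothesis Kfree : forall L, size L = s.+2 -> ~~ pairwise adj L.

Lemma no_clique_of_close_classes (c : 'I_s.+2 -> V) :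
  ~ (forall i j, i != j -> exists x y, [/\ adj x y, close x (c i) & close y (c j)]).
Proof.
move=> edges.
(* Diagonal pairs get a dummy witness, so that the sums below run over all ordered pairs. *)
have /fin_all_exists[w wP] : forall z : 'I_s.+2 * 'I_s.+2, exists w : V * V,
    [/\ close w.1 (c z.1), close w.2 (c z.2) & z.1 != z.2 -> adj w.1 w.2].
  move=> [i j] /=; have [->|/edges[x [y [xy xi yj]]]] := eqVneq i j.
    by exists (c j, c j); split; rewrite ?close_refl.
  by exists (x, y).
pose G := [set Q : s.-tuple V |
  pairwise adj (catrev Q [::]) && doubly_dominated c (catrev Q [::])].
have cardG : e ^ s <= 2 ^ s * #|G|.
  apply: (count_dominated_cliques nondeg s_gt0 degE (J := enum 'I_s.+2)) => //.
    exact: enum_uniq.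
  by rewrite size_enum_ord.
pose B z := #|separating (w z).1 (c z.1)| + #|separating (w z).2 (c z.2)|.
(* Both centres dominating [Q] have an empty link, while one end of the edge between their classes
   is heavy; [Q] separates that end from its centre. *)
have coverG : #|G| <= \sum_z B z.
  rewrite /B big_split /=.
  have -> : \sum_z #|separating (w z).1 (c z.1)| =
    \sum_Q #|[set z | Q \in separating (w z).1 (c z.1)]|.
    rewrite -sum_card_exchange; apply: eq_bigr => z _; congr #|pred_of_set _|.
    by apply/setP => Q; rewrite [RHS]inE.
  have -> : \sum_z #|separating (w z).2 (c z.2)| =
    \sum_Q #|[set z | Q \in separating (w z).2 (c z.2)]|.
    rewrite -sum_card_exchange; apply: eq_bigr => z _; congr #|pred_of_set _|.
    by apply/setP => Q; rewrite [RHS]inE.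
  rewrite -big_split -sum1_card big_mkcond /=; apply: leq_sum => Q _.
  case: ifP => //; rewrite inE => /andP[pQ /existsP[i /existsP[j /and3P[ij iQ jQ]]]].
  have sQ : size (catrev Q [::]) = s by rewrite [catrev _ _]/(rev Q) size_rev size_tuple.
  have [wi wj /(_ ij) wij] := wP (i, j).
  have linkrev u : link u (catrev Q [::]) = link u Q.
    by apply/setP => x; rewrite !inE [catrev _ _]/(rev Q) all_rev.
  have ge_e := link_edge nondeg s_gt0 degE Kfree sQ wij.
  have ci0 := link_clique Kfree sQ pQ iQ; have cj0 := link_clique Kfree sQ pQ jQ.
  move: ge_e ci0 cj0; rewrite !linkrev => ge_e ci0 cj0.
  rewrite addn_gt0 !card_gt0; apply/orP.
  have [h|h] := boolP (heavy (w (i, j)).1 Q).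
    by left; apply/set0Pn; exists (i, j); rewrite !inE h ci0 eqxx.
  right; apply/set0Pn; exists (i, j); rewrite !inE cj0 eqxx andbT.
  move: h ge_e n_le_e; rewrite /heavy /= -ltnNge.
  move: #|link _ _| #|link _ _| => a b; clear -p_gt0 => h1 h2 h3.
  by nia.
have sumB : rare_factor * \sum_z B z < 2 * s.+2 ^ 2 * n ^ s.
  (* The predecessor keeps the inequality strict after summation. *)
  have le z : rare_factor * B z <= 2 * (n ^ s).-1.
    have [w1 w2 _] := wP z; rewrite /B mulnDr mul2n -addnn.
    by apply: leq_add; rewrite -ltnS prednK ?expn_gt0 ?n_gt0.
  rewrite big_distrr /=; apply: leq_ltn_trans (leq_sum _ (fun z _ => le z)) _.
  rewrite sum_nat_const card_prod card_ord.
  have : 0 < n ^ s by rewrite expn_gt0 n_gt0.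
  by move: (n ^ s) => a; nia.
(* Conversely, [n^s <= (p * e)^s <= (2p)^s * #|G|]. *)
have : 2 * s.+2 ^ 2 * n ^ s <= rare_factor * \sum_z B z.
  apply: (@leq_trans (rare_factor * #|G|)); last by rewrite leq_mul2l coverG orbT.
  rewrite /rare_factor; set r2 := 2 * s.+2 ^ 2.
  rewrite [(2 * p) ^ s * _]mulnC -[leqRHS]mulnA leq_mul2l; apply/orP; right.
  apply: (@leq_trans ((p * e) ^ s)); first by rewrite leq_exp2r.
  by rewrite !expnMn [2 ^ s * p ^ s]mulnC -[leqRHS]mulnA leq_mul2l cardG orbT.
by rewrite leqNgt sumB.
Qed.

End Quotient.
End Sampling.
End DenseGraph.

(** * Quotient graphs *)

Lemma pairwise_enum (T : finType) (e : rel T) :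
  (forall x y, x != y -> e x y) -> pairwise e (enum T).
Proof.
move=> eP; have := enum_uniq T; rewrite uniq_pairwise.
by apply: sub_pairwise => x y; apply: eP.
Qed.

Lemma Forb_complete_noclique (r : nat) (G : sgraph) : Forb (complete_graph r) G ->
  forall L : seq G, size L = r -> ~~ pairwise (@adj G) L.
Proof.
move=> FG L sL; apply/negP => pL; apply: FG.
pose t : r.-tuple G := Tuple (introT eqP sL).
have hom (i j : 'I_r) : i != j -> adj (tnth t i) (tnth t j).
  move=> ij.
  wlog lt : i j ij / i < j.
    move=> W; case: (ltngtP i j) => h; first exact: W.
      by rewrite adj_sym; apply: W; rewrite // eq_sym.
    by case/negP: ij; apply/eqP/val_inj.
  have x0 : G by exact: tnth t i.
  rewrite !(tnth_nth x0) /=; move/(pairwiseP x0): pL; apply => //=.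
    by rewrite inE sL.
  by rewrite inE sL.
exists (tnth t); split; last exact: hom.
move=> i j eqij; apply: contraTeq isT => /hom; rewrite eqij.
by rewrite adj_irrefl.
Qed.

Lemma noclique_Forb_complete (r : nat) (G : sgraph) :
  (forall L : seq G, size L = r -> ~~ pairwise (@adj G) L) -> Forb (complete_graph r) G.
Proof.
move=> H [phi [_ hom]]; have := H (map phi (enum 'I_r)).
rewrite size_map size_enum_ord => /(_ erefl)/negP; apply.
by rewrite pairwise_map; apply: pairwise_enum => i j; apply: hom.
Qed.

Lemma leq_min_degree (G : sgraph) (v : G) : min_degree G <= degree v.
Proof.
rewrite /min_degree; have := mem_index_enum v.
elim: (index_enum _) => [//|w l IH]; rewrite inE big_cons geq_min.
by move=> /predU1P[->|/IH->]; rewrite ?leqnn ?orbT.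
Qed.

Section ImageGraph.
Variables (G : sgraph) (k : nat) (f : G -> 'I_k).

Definition image_adj (i j : 'I_k) : bool :=
  [exists x, exists y, [&& adj x y, f x == i & f y == j]].

Lemma image_adj_sym : symmetric image_adj.
Proof.
suff H i j : image_adj i j -> image_adj j i by move=> i j; apply/idP/idP; apply: H.
move=> /existsP[x /existsP[y /and3P[xy xi yj]]].
by apply/existsP; exists y; apply/existsP; exists x; rewrite adj_sym xy xi yj.
Qed.

Lemma image_graph_hom (r : nat) : 1 < r ->
    (forall c : 'I_r -> 'I_k, ~ forall i j, i != j -> image_adj (c i) (c j)) ->
  exists H : sgraph, Forb_on k (complete_graph r) H /\ hom_to G H.
Proof.
move=> r1 noclique.
have irr : irreflexive image_adj.
  (* At a loop, the constant map would be a clique. *)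
  by move=> i; apply/negbTE/negP => ii; apply: (noclique (fun=> i)) => ? ? _.
exists (SGraph image_adj_sym irr); split; last first.
  exists f => x y xy; apply/existsP; exists x; apply/existsP; exists y.
  by rewrite xy !eqxx.
by split; [case=> c [_ hom]; apply: (noclique c) => i j; apply: hom|rewrite card_ord].
Qed.

End ImageGraph.

(** The degree condition is [n <= p * e] rewritten with [d = n - min_degree G] and
    [e = 2n - (2s+1)d]. *)
Lemma dense_bounded_hom (s p : nat) : 0 < s -> 0 < p ->
  exists k, forall G : sgraph, Forb (complete_graph s.+2) G ->
    (1 + p * s.*2.-1) * #|G| <= p * s.*2.+1 * min_degree G ->
    exists H : sgraph, Forb_on k (complete_graph s.+2) H /\ hom_to G H.
Proof.
move=> s0 p0; have [|m] := @exists_exponent (2 * p).-1 (2 * rare_factor s p); first by lia.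
rewrite prednK ?muln_gt0 // => m_large; exists (2 * 2 ^ m) => G FG degG.
have [n0|n0] := posnP #|G|.
  have k0 : 0 < 2 * 2 ^ m by rewrite muln_gt0 expn_gt0.
  apply: (@image_graph_hom G _ (fun=> Ordinal k0)) => // c.
  have ne : (ord0 : 'I_s.+2) != ord_max by [].
  by move=> /(_ _ _ ne)/existsP[x _]; move/card0_eq/(_ x): n0; rewrite !inE.
have [f [cen fcen]] := @bounded_close_labelling G (@adj G) _ erefl s p p0 n0 m m_large.
apply: (@image_graph_hom G _ f) => // c cadj.
pose d := #|G| - min_degree G.
have nondeg (v : G) : #|[set u | ~~ adj v u]| <= d.
  have -> : [set u | ~~ adj v u] = ~: [set u | adj v u] by apply/setP => u; rewrite !inE.
  by rewrite cardsCs setCK leq_sub2l // cardsE; apply: leq_min_degree.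
have le : min_degree G <= #|G|.
  by case/card_gt0P: n0 => v _; apply: leq_trans (leq_min_degree v) (max_card _).
apply: (@no_clique_of_close_classes G (@adj G) (@adj_sym G) #|G| erefl s p p0 n0 d
  (2 * #|G| - s.*2.+1 * d) nondeg s0 _ _ (Forb_complete_noclique FG) (cen \o c)).
- suff : s.*2.+1 * d <= 2 * #|G| by lia.
  move: degG; rewrite /d; move: #|G| (min_degree G) le n0 => n dl le n0.
  by clear -s0 p0 le n0; nia.
- move: degG; rewrite /d; move: #|G| (min_degree G) le n0 => n dl le n0.
  by clear -s0 p0 le n0; nia.
- move=> i j /cadj/existsP[x /existsP[y /and3P[xy /eqP xi /eqP yj]]].
  by exists x, y; split=> //=; rewrite -?xi -?yj.
Qed.

Lemma leq_min_degreeP (G : sgraph) (a : nat) : a <= #|G| ->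
  (forall v : G, a <= degree v) -> a <= min_degree G.
Proof.
move=> aG aP; rewrite /min_degree; elim/big_ind: _ => // x y ax ay.
by rewrite leq_min ax.
Qed.

(** * The extremal construction *)

Section LowerGraph.
Variables (t k M : nat).

Definition cell : finType := ('I_k.+1 * 'I_M)%type.

(* [BlockA] and each [BlockP l] have [2 * k.+1 * M] vertices, [BlockB] half as
   many; [BlockU] is the matching. *)
Inductive block := BlockA of bool & cell | BlockB of cell
  | BlockP of 'I_t & bool & cell | BlockU of 'I_k.+1 & bool.

Definition block_encode (x : block) :
    bool * cell + cell + 'I_t * (bool * cell) + 'I_k.+1 * bool :=
  match x with
  | BlockA b z => inl (inl (inl (b, z)))
  | BlockB z => inl (inl (inr z))
  | BlockP l b z => inl (inr (l, (b, z)))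
  | BlockU i b => inr (i, b)
  end.

Definition block_decode
    (x : bool * cell + cell + 'I_t * (bool * cell) + 'I_k.+1 * bool) : block :=
  match x with
  | inl (inl (inl (b, z))) => BlockA b z
  | inl (inl (inr z)) => BlockB z
  | inl (inr (l, (b, z))) => BlockP l b z
  | inr (i, b) => BlockU i b
  end.

Lemma block_encodeK : cancel block_encode block_decode. Proof. by case. Qed.
Lemma block_decodeK : cancel block_decode block_encode.
Proof. by case=> [[[[b z]|z]|[l [b z]]]|[i b]]. Qed.

HB.instance Definition _ := Equality.copy block (can_type block_encodeK).
HB.instance Definition _ := Choice.copy block (can_type block_encodeK).
HB.instance Definition _ := Countable.copy block (can_type block_encodeK).
HB.instance Definition _ := Finite.copy block (can_type block_encodeK).

(* [BlockU i false] and [BlockU i true] split [BlockA]: among the vertices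
   [BlockA true (j, _)], the first is adjacent to those with [j = i] and the
   second to those with [j <> i]. *)
Definition block_adj (x y : block) : bool :=
  match x, y with
  | BlockA _ _, BlockB _ | BlockB _, BlockA _ _ => true
  | BlockA b z, BlockU i b' | BlockU i b', BlockA b z => b == (z.1 == i) (+) b'
  | BlockU i b, BlockU i' b' => (i == i') && (b != b')
  | BlockP l _ _, BlockP l' _ _ => l != l'
  | BlockP _ _ _, _ | _, BlockP _ _ _ => true
  | _, _ => false
  end.

Lemma block_adj_sym : symmetric block_adj.
Proof.
by case=> [b z|z|l b z|i b] [b' z'|z'|l' b' z'|i' b'] //=;
  rewrite ?(eq_sym i) ?(eq_sym b) ?(eq_sym l).
Qed.

Lemma block_adj_irrefl : irreflexive block_adj.
Proof. by case=> [b z|z|l b z|i b] //=; rewrite !eqxx. Qed.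

Definition block_graph : sgraph := SGraph block_adj_sym block_adj_irrefl.

Lemma sum_block (F : block -> nat) : \sum_x F x =
  \sum_b \sum_z F (BlockA b z) + \sum_z F (BlockB z) +
  \sum_l \sum_b \sum_z F (BlockP l b z) + \sum_i \sum_b F (BlockU i b).
Proof.
rewrite (reindex block_decode); last first.
  by exists block_encode => x _; rewrite ?block_encodeK ?block_decodeK.
rewrite !big_sumType /=; congr (_ + _ + _ + _).
- by rewrite pair_bigA; apply: eq_bigr => -[].
- rewrite (eq_bigr (fun l => \sum_(w : bool * cell) F (BlockP l w.1 w.2)));
    last by move=> l _; rewrite pair_bigA.
  by rewrite pair_bigA; apply: eq_bigr => -[l []].
- by rewrite pair_bigA; apply: eq_bigr => -[].
Qed.

Local Notation q := (k.+1 * M).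

Lemma card_cell : #|cell| = q. Proof. by rewrite card_prod !card_ord. Qed.

Lemma card_block : #|block_graph| = (t.*2 + 3) * q + k.+1.*2.
Proof.
rewrite -sum1_card sum_block !sum_nat_const !card_ord card_bool card_cell.
by move: q => a; nia.
Qed.

Lemma sum_other (l : 'I_t) a : \sum_(l' < t) (l != l') * a = t.-1 * a.
Proof.
rewrite -big_distrl /= sum_bool_card; congr (_ * _).
have := cardsC1 l; rewrite card_ord => <-; apply: eq_card => x.
by rewrite !inE eq_sym.
Qed.

(** The Boolean in [BlockA] balances the two halves: a matching vertex sees exactly [q] vertices of
    [BlockA], as many as a vertex of [BlockA] sees in [BlockB]. *)
Lemma degree_block (x : block_graph) : t.*2.+1 * q <= degree x.
Proof.
rewrite /degree -cardsE -sum_bool_card sum_block.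
have sumP a : \sum_(l < t) \sum_(b : bool) \sum_(z : cell) a = t * (2 * (q * a)).
  by rewrite !sum_nat_const card_ord card_bool card_cell.
case: x => [b z|z|l b z|i b] /=.
- rewrite !sumP !sum_nat_const card_cell; move: q => a; nia.
- rewrite !sumP !sum_nat_const card_cell card_bool; move: q => a; nia.
- rewrite !sum_nat_const card_cell card_bool.
  have -> : \sum_(l' < t) \sum_(b' : bool) \sum_(z' : cell) (l != l' : nat) = t.-1 * (2 * q).
    rewrite -(sum_other l); apply: eq_bigr => l' _.
    by rewrite !sum_nat_const card_cell card_bool; move: q => a; nia.
  by case: t l => [[]//|t' _] /=; move: q => a; nia.
- rewrite !sumP exchange_big /=.
  have -> : \sum_(z : cell) \sum_b' (b' == (z.1 == i) (+) b) = q.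
    rewrite -card_cell -sum1_card; apply: eq_bigr => z _.
    by rewrite big_bool; case: (_ (+) _).
  by move: q => a; nia.
Qed.

Definition part (x : block) : option 'I_t := if x is BlockP l _ _ then Some l else None.

(** Outside [BlockP] a triangle would need a matching edge and a vertex of [BlockA] adjacent to both
    ends, but the ends split [BlockA]. *)
Lemma block_triangle_meets_P (x y z : block) :
  [&& block_adj x y, block_adj x z & block_adj y z] -> [|| part x, part y | part z].
Proof.
case: x => [b1 z1|z1|l1 b1 z1|i1 b1] //; case: y => [b2 z2|z2|l2 b2 z2|i2 b2] //;
case: z => [b3 z3|z3|l3 b3 z3|i3 b3] //=; rewrite ?andbF //.
- case/and3P => h1 h2 /andP[/eqP e h3]; move: h1 h2 h3; rewrite e.
  by case: (_ == i3); case: b1; case: b2; case: b3.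
- case/and3P => h1 /andP[/eqP e h3] h2; move: h1 h2 h3; rewrite e.
  by case: (_ == i3); case: b1; case: b2; case: b3.
- case/and3P => /andP[/eqP e h3] h1 h2; move: h1 h2 h3; rewrite e.
  by case: (_ == i2); case: b1; case: b2; case: b3.
- by case/and3P => /andP[_ +] /andP[_ +] /andP[_ +]; case: b1; case: b2; case: b3.
Qed.

(** A clique has at most one vertex in each of the [t] parts of [BlockP], leaving three outside. *)
Lemma block_noclique (L : seq block_graph) : size L = t.+3 -> ~~ pairwise block_adj L.
Proof.
move=> sL; apply/negP => pL.
have leP : size (pmap part L) <= t.
  rewrite -[leqRHS]card_ord -[leqLHS](card_uniqP _) ?max_card //.
  elim: L pL {sL} => [//|x L IH] /= /andP[xL /IH uL]; case: x xL => //= l b z xL.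
  rewrite uL andbT mem_pmap; apply/negP => /mapP[y yL].
  by have := allP xL y yL; case: y yL => //= l' b' z' _ ll' [El]; rewrite El eqxx in ll'.
pose P (x : block) := isSome (part x).
have countP : count P L <= t by move: leP; rewrite size_pmap.
have : 2 < size (filter (predC P) L).
  by have := count_predC P L; rewrite sL size_filter; lia.
have := pairwise_filter (predC P) pL; have := filter_all (predC P) L.
case: (filter _ _) => [|x [|y [|z L']]] //= /and4P[nx ny nz _].
case/and3P => /and3P[xy xz _] /andP[yz _] _ _.
have := @block_triangle_meets_P x y z; rewrite xy xz yz => /(_ isT).
by move: nx ny nz; rewrite /P; case: (part x); case: (part y); case: (part z).
Qed.

Hypothesis M_gt0 : 0 < M.

Lemma block_graph_no_hom (H : sgraph) :
  Forb_on k (complete_graph t.+3) H -> ~ hom_to block_graph H.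
Proof.
case=> FH cardH [phi hom].
pose z0 : 'I_M := Ordinal M_gt0.
pose f (i : 'I_k.+1) : H := phi (BlockA true (i, z0)).
have /injectivePn[i [j ij fij]] : ~~ injectiveb f.
  by apply/negP => /injectiveP/leq_card; rewrite card_ord cardH ltnn.
have := Forb_complete_noclique FH (L := [:: phi (BlockA true (i, z0)),
  phi (BlockU i false), phi (BlockU i true) &
  [seq phi (BlockP l true (i, z0)) | l <- enum 'I_t]]).
rewrite /= size_map size_enum_ord => /(_ erefl)/negP; apply.
have joined x : ~~ part x ->
    all (adj (phi x)) [seq phi (BlockP l true (i, z0)) | l <- enum 'I_t].
  move=> xP; apply/allP => _ /mapP[l _ ->]; by apply: hom; case: x xP.
rewrite !joined // !andbT; apply/andP; split; first (apply/andP; split).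
- by apply: hom; rewrite /= eqxx.
(* The representative of [j] has the same image and, as [j <> i], is adjacent to [BlockU i true]. *)
- by rewrite -[phi _]/(f i) fij; apply: hom; rewrite /= (eq_sym j) (negbTE ij).
- rewrite pairwise_map; apply/andP; split; first by apply: hom; rewrite /= eqxx.
  by apply: pairwise_enum => l l' ll'; apply: hom.
Qed.

End LowerGraph.

Lemma dense_graph_no_bounded_hom (t k M : nat) : 0 < M ->
  exists G : sgraph, [/\ Forb (complete_graph t.+3) G,
    t.*2.+1 * (k.+1 * M) <= min_degree G, #|G| = (t.*2 + 3) * (k.+1 * M) + k.+1.*2 &
    forall H, Forb_on k (complete_graph t.+3) H -> ~ hom_to G H].
Proof.
move=> M0; exists (block_graph t k M); split.
- by apply: noclique_Forb_complete; apply: block_noclique.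
- apply: leq_min_degreeP (@degree_block t k M).
  by rewrite card_block; move: (_ * M) => a; nia.
- exact: card_block.
- exact: block_graph_no_hom.
Qed.

(** * The threshold *)

From mathcomp Require Import all_classical all_reals.
Local Open Scope ring_scope.

Lemma exists_natmul_ge (R : realType) (x a : R) : 0 < x ->
  exists2 p : nat, (0 < p)%N & a <= p%:R * x.
Proof.
move=> x0; exists (Num.bound `|a / x|).+1 => //.
rewrite -ler_pdivrMr //; apply: le_trans (ler_norm _) _.
by apply: ltW; apply: lt_trans (archi_boundP (normr_ge0 _)) _; rewrite ltr_nat.
Qed.

Definition hom_bounded (R : realType) (r : nat) (alpha : R) : Prop :=
  exists k : nat, forall G : sgraph, Forb (complete_graph r) G ->
    alpha * #|G|%:R <= (min_degree G)%:R ->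
    exists H : sgraph, Forb_on k (complete_graph r) H /\ hom_to G H.

Lemma hom_bounded_above (R : realType) (t : nat) (alpha : R) :
  t.*2.+1%:R < alpha * (t.*2 + 3)%:R -> hom_bounded t.+3 alpha.
Proof.
(* [p] is the reciprocal of the excess over the threshold, rounded up. *)
move=> lt; have [|p p0 pP] := @exists_natmul_ge R (alpha * (t.*2 + 3)%:R - t.*2.+1%:R) 1.
  by rewrite subr_gt0.
have [k kP] := @dense_bounded_hom t.+1 p isT p0.
exists k => G FG degG; apply: kP => //.
rewrite -(ler_nat R) doubleS /= -addn3.
have n0 : 0 <= #|G|%:R :> R by [].
have := ler_wpM2r n0 pP; have := ler_wpM2l (ler0n R (p * (t.*2 + 3))) degG.
rewrite !natrM !natrD !natrM; lra.
Qed.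

Lemma hom_bounded_below (R : realType) (t : nat) (alpha : R) : 0 <= alpha ->
  hom_bounded t.+3 alpha -> t.*2.+1%:R <= alpha * (t.*2 + 3)%:R.
Proof.
move=> a0 [k kP]; rewrite leNgt; apply/negP => lt.
(* [M] is large enough for the deficit below the threshold to absorb the [2(k+1)] matching
   vertices. *)
have [|M M0 MP] := @exists_natmul_ge R (t.*2.+1%:R - alpha * (t.*2 + 3)%:R) (2 * alpha).
  by rewrite subr_gt0.
have [G [FG degG cardG noH]] := @dense_graph_no_bounded_hom t k M M0.
have [|H [FH homH]] := kP G FG; last exact: noH FH homH.
apply: (@le_trans _ _ (t.*2.+1 * (k.+1 * M))%:R); last by rewrite ler_nat.
have := ler_wpM2l (ler0n R k.+1) MP.
by rewrite cardG -[k.+1.*2]muln2 !(natrD, natrM); lra.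
Qed.

Theorem theorem1p1 (R : realType) (r : nat) (hr : (3 <= r)%N) :
  hom_threshold R (complete_graph r) = (2 * r%:R - 5) / (2 * r%:R - 3).
Proof.
case: r hr => [|[|[|t]]] // _.
have d0 : 0 < (t.*2 + 3)%:R :> R by rewrite ltr0n addn3.
have -> : (2 * t.+3%:R - 5) / (2 * t.+3%:R - 3) = t.*2.+1%:R / (t.*2 + 3)%:R :> R.
  congr (_ / _); rewrite -mul2n ?natrD -?natr1 ?natrM; lra.
set thr : R := _ / _.
have thr1 : thr < 1 by rewrite ltr_pdivrMr // mul1r ltr_nat addn3.
have thr0 : 0 <= thr by rewrite divr_ge0.
rewrite /hom_threshold; set S : set R := (X in inf X).
have memS (alpha : R) : thr < alpha <= 1 -> S alpha.
  move=> /andP[gt le1]; split; first by rewrite le1 (le_trans thr0 (ltW gt)).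
  by apply: hom_bounded_above; rewrite -ltr_pdivrMr.
have lbS : lbound S thr.
  by move=> alpha [/andP[a0 _] /(hom_bounded_below a0)]; rewrite ler_pdivrMr.
have S0 : nonempty S by exists 1; apply: memS; rewrite thr1 lexx.
apply/le_anti/andP; split; last exact: lb_le_inf.
apply/ler_addgt0Pr => eps eps0.
have infS (alpha : R) : S alpha -> inf S <= alpha by apply: ge_inf; exists thr.
(* If [thr + eps] exceeds 1, it is not admissible and [alpha = 1] serves instead. *)
have [le1|gt1] := leP (thr + eps) 1.
  by apply/infS/memS; rewrite ltrDl eps0.
by apply: le_trans (ltW gt1); apply/infS/memS; rewrite thr1 lexx.
Qed.
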